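(* Let $\Sigma$ be a surface of positive constant width $w$ with principal radii of curvature $\rho_0,\rho_1$, and let $P,Q\in\Sigma$ be opposite points. Then $$\rho_0(P)+\rho_1(Q)=w.$$
   Context: An ovoid is a bounded simply connected convex smooth surface $\Sigma\subset\mathbb{R}^3$ that has a tangent plane at each point and lies entirely on one side of each tangent plane; the origin is chosen inside $\Sigma$. Its support function $p(t,u)$ is the distance from the origin to the tangent plane with unit outward normal $\mathbf{n}=(\cos t\sin u,\ \sin t\sin u,\ \cos u)$, $0\le t<2\pi$, $0\le u\le\pi$; $p$ is assumed to be sufficiently differentiable (derivatives through second order are used), and points of $\Sigma$ are parametrized by $(t,u)$: the point with parameters $(t,u)$ is the point of $\Sigma$ with outward normal $\mathbf{n}(t,u)$. The width in direction $\mathbf{n}$ is $w(t,u)=p(t,u)+p(t+\pi,\pi-u)$, and $\Sigma$ is a surface of constant width $w$ if $w(t,u)=w$ for all $(t,u)$. Points $P$ and $Q$ of $\Sigma$ are opposite if $P$ has parameters $(t,u)$ and $Q$ has parameters $(t+\pi,\pi-u)$, i.e. the outward normal at $Q$ is the negative of that at $P$. The principal radii of curvature at a point are the reciprocals $\rho_k=1/\kappa_k$, $k=0,1$, of the principal curvatures; equivalently, they are the eigenvalues of $\nabla^2p+p\,I$ on the tangent plane at $\mathbf{n}$ of the unit sphere, where $p$ is regarded as a function on the sphere and $\nabla^2$ is the spherical Hessian (this also covers a vanishing radius). They are labelled at every point so that $\rho_0\ge\rho_1$. *)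

(* Defs.v *)
From HB Require Import structures.
From mathcomp Require Import all_boot all_order all_algebra.
From mathcomp Require Import all_classical all_reals all_analysis.
Set Implicit Arguments.
Unset Strict Implicit.
Unset Printing Implicit Defensive.
Import Order.TTheory GRing.Theory Num.Theory.
Import numFieldNormedType.Exports.
Local Open Scope classical_set_scope.
Local Open Scope ring_scope.

(* The library norm on 'rV[R]_3 is the sup norm; it is used here only through
   the topology it induces.  All metric notions go through [dot] and [enorm]. *)
Definition dot (R : realType) (x y : 'rV[R]_3) : R := (x *m y^T) 0 0.

Definition enorm (R : realType) (x : 'rV[R]_3) : R := Num.sqrt (dot x x).

Definition unit_vec (R : realType) (n : 'rV[R]_3) : Prop := dot n n = 1.

(* [tangent_plane_at S X n]: the plane through X orthogonal to n is tangent to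
   S at X, i.e. the sine of the angle between this plane and the chord XY
   tends to 0 as Y tends to X on S.  (At Y = X the quotient is 0 / 0 = 0.) *)
Definition tangent_plane_at (R : realType) (S : set 'rV[R]_3)
    (X n : 'rV[R]_3) : Prop :=
  [/\ S X, unit_vec n
    & dot (Y - X) n / enorm (Y - X) @[Y --> within S (nbhs X)] --> (0 : R)].

(* A closed (bounded, simply connected) convex surface is the boundary of a
   compact convex body; the origin is chosen inside. *)
Definition ovoid (R : realType) (S : set 'rV[R]_3) : Prop :=
  [/\ exists K : set 'rV[R]_3,
        [/\ compact K, convex_set K, interior K 0
          & S = closure K `\` interior K],
      forall X, S X -> exists n, tangent_plane_at S X n
    & forall X n, tangent_plane_at S X n ->
        (forall Y, S Y -> dot (Y - X) n <= 0) \/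
        (forall Y, S Y -> 0 <= dot (Y - X) n)].

Definition outward_normal (R : realType) (S : set 'rV[R]_3)
    (X n : 'rV[R]_3) : Prop :=
  tangent_plane_at S X n /\ forall Y, S Y -> dot (Y - X) n <= 0.

(* The tangent plane with unit outward normal n.  All points X of S with
   outward normal n give the same plane. *)
Definition tangent_plane (R : realType) (S : set 'rV[R]_3) (n : 'rV[R]_3) :
    set 'rV[R]_3 :=
  [set Y | exists X, outward_normal S X n /\ dot (Y - X) n = 0].

(* The support function as a function on the unit sphere. *)
Definition support_fun (R : realType) (S : set 'rV[R]_3) (n : 'rV[R]_3) : R :=
  inf [set enorm Y | Y in tangent_plane S n].

Definition normal_vec (R : realType) (t u : R) : 'rV[R]_3 :=
  \row_(i < 3) [:: cos t * sin u; sin t * sin u; cos u]`_i.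

Definition support_param (R : realType) (S : set 'rV[R]_3) (t u : R) : R :=
  support_fun S (normal_vec t u).

Definition width (R : realType) (S : set 'rV[R]_3) (t u : R) : R :=
  support_param S t u + support_param S (t + pi) (pi - u).

Definition param_range (R : realType) (t u : R) : Prop :=
  0 <= t < 2 * pi /\ 0 <= u <= pi.

Definition constant_width (R : realType) (S : set 'rV[R]_3) (w : R) : Prop :=
  forall t u : R, param_range t u -> width S t u = w.

Definition has_param (R : realType) (S : set 'rV[R]_3) (X : 'rV[R]_3)
    (t u : R) : Prop :=
  outward_normal S X (normal_vec t u).

(* t + pi is an angle modulo 2 * pi, hence need not be smaller than 2 * pi. *)
Definition opposite (R : realType) (S : set 'rV[R]_3) (P Q : 'rV[R]_3) : Prop :=
  exists t u : R,
    [/\ param_range t u, has_param S P t u & has_param S Q (t + pi) (pi - u)].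

(* A function f on the unit sphere is only evaluated at unit vectors; it is
   differentiated through its extension x |-> f (x / |x|) to x <> 0. *)
Definition radial_ext (R : realType) (f : 'rV[R]_3 -> R) (x : 'rV[R]_3) : R :=
  f ((enorm x)^-1 *: x).

Definition basis_vec (R : realType) (i : 'I_3) : 'rV[R]_3 := delta_mx 0 i.

(* At a unit vector x this is the spherical gradient of f at x: the extension
   is constant along rays, so its Euclidean gradient is tangential. *)
Definition sphere_grad (R : realType) (f : 'rV[R]_3 -> R) (x : 'rV[R]_3) :
    'rV[R]_3 :=
  \row_(i < 3) 'D_(basis_vec R i) (radial_ext f) x.

Definition C2_on_sphere (R : realType) (f : 'rV[R]_3 -> R) : Prop :=
  forall x : 'rV[R]_3, x != 0 ->
    [/\ differentiable (radial_ext f) x,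
        differentiable (sphere_grad f) x
      & forall i j : 'I_3,
          {for x, continuous
             ('D_(basis_vec R j) ('D_(basis_vec R i) (radial_ext f)))}].

(* Orthogonal projection onto the tangent plane of the unit sphere at n. *)
Definition tangent_proj (R : realType) (n v : 'rV[R]_3) : 'rV[R]_3 :=
  v - dot v n *: n.

(* The spherical Hessian as the endomorphism v |-> nabla_v (grad f) of the
   tangent plane at the unit vector n; the Levi-Civita derivative on the sphere
   is the tangential part of the Euclidean one.  For v tangent at n, the latter
   depends only on the values of the gradient field on the sphere. *)
Definition sphere_hessian (R : realType) (f : 'rV[R]_3 -> R)
    (n v : 'rV[R]_3) : 'rV[R]_3 :=
  tangent_proj n ('D_v (sphere_grad f) n).

(* a is an eigenvalue of nabla^2 f + f I on the tangent plane at n. *)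
Definition radius_eigenvalue (R : realType) (f : 'rV[R]_3 -> R)
    (n : 'rV[R]_3) (a : R) : Prop :=
  exists v : 'rV[R]_3,
    [/\ v != 0, dot v n = 0 & sphere_hessian f n v + f n *: v = a *: v].

(* The operator is self-adjoint on a plane, so it is diagonalizable and its
   eigenvalues counted with multiplicity are determined by the set of its
   eigenvalues: rho0 X = rho1 X exactly when there is only one. *)
Definition principal_radii (R : realType) (S : set 'rV[R]_3)
    (rho0 rho1 : 'rV[R]_3 -> R) : Prop :=
  forall X n : 'rV[R]_3, outward_normal S X n ->
    rho1 X <= rho0 X /\
    forall a : R, radius_eigenvalue (support_fun S) n a <-> a = rho0 X \/ a = rho1 X.

(* Main.v *)
Require Import Defs.
From HB Require Import structures.
From mathcomp Require Import all_boot all_order all_algebra.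
From mathcomp Require Import all_classical all_reals all_analysis.
From mathcomp Require Import ring lra.
Import Order.TTheory GRing.Theory Num.Theory.
Import numFieldNormedType.Exports.
Local Open Scope classical_set_scope.
Local Open Scope ring_scope.

(** Let [p] be the support function and [A n] the operator
[v |-> sphere_hessian p n v + p n *: v] on the tangent plane at [n], whose
eigenvalues are the principal radii at the point with outward normal [n].
Every unit vector has spherical coordinates in the prescribed range, so
constant width says [p n + p (- n) = w] on the whole sphere
([support_fun_antipodal]).  Hence the radial extension [F] of [p] satisfies
[F (- x) = w - F x] away from [0].  Differentiating once, the gradient is an
even field ([sphere_grad_opp]); differentiating again, the Hessian is odd
([sphere_hessian_opp]).  Therefore [A (- n) = w - A n] on the common tangent
plane at [n] and [- n], and [a |-> w - a] is an order-reversing map from the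
principal radii at a point to those at the opposite point
([radius_eigenvalue_opp]), which sends the larger one to the smaller
one. *)

(** * Unit vectors *)

Lemma dotE (R : realType) (x y : 'rV[R]_3) :
  dot x y = x 0 0 * y 0 0 + x 0 1 * y 0 1 + x 0 (inord 2) * y 0 (inord 2).
Proof.
rewrite /dot mxE !big_ord_recl big_ord0 addr0 !mxE addrA.
by congr (_ * _ + _ * _ + _ * _); congr (_ _ _); apply/val_inj;
  rewrite /= ?inordK.
Qed.

Lemma dotNr (R : realType) (x y : 'rV[R]_3) : dot x (- y) = - dot x y.
Proof. by rewrite !dotE !mxE; ring. Qed.

Lemma dotNN (R : realType) (x y : 'rV[R]_3) : dot (- x) (- y) = dot x y.
Proof. by rewrite !dotE !mxE; ring. Qed.

Lemma dotZZ (R : realType) (a : R) (x : 'rV[R]_3) :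
  dot (a *: x) (a *: x) = a ^+ 2 * dot x x.
Proof. by rewrite !dotE !mxE; ring. Qed.

Lemma row3P (R : realType) (x y : 'rV[R]_3) :
  x 0 0 = y 0 0 -> x 0 1 = y 0 1 -> x 0 (inord 2) = y 0 (inord 2) -> x = y.
Proof.
move=> h0 h1 h2; apply/rowP => -[[|[|[|//]]] hi].
- by have -> : Ordinal hi = 0 by exact/val_inj.
- by have -> : Ordinal hi = 1 by exact/val_inj.
- by have -> : Ordinal hi = inord 2 by apply/val_inj; rewrite /= inordK.
Qed.

Lemma dot_gt0 (R : realType) (x : 'rV[R]_3) : x != 0 -> 0 < dot x x.
Proof.
move=> x0; rewrite lt_neqAle dotE -!expr2 !addr_ge0 ?sqr_ge0// andbT eq_sym.
apply: contra x0; rewrite !paddr_eq0 ?addr_ge0 ?sqr_ge0// !sqrf_eq0.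
by move=> /andP[/andP[/eqP h0 /eqP h1] /eqP h2]; apply/eqP/row3P;
  rewrite ?h0 ?h1 ?h2 mxE.
Qed.

Lemma unit_vec_normalize (R : realType) (x : 'rV[R]_3) :
  x != 0 -> unit_vec ((enorm x)^-1 *: x).
Proof.
move=> /dot_gt0 x0.
by rewrite /unit_vec dotZZ exprVn sqr_sqrtr ?(ltW x0)// mulVf ?(gt_eqF x0).
Qed.

Lemma unit_vec_neq0 (R : realType) (n : 'rV[R]_3) : unit_vec n -> n != 0.
Proof.
rewrite /unit_vec => n1; apply/eqP => n0; move: n1.
by rewrite n0 dotE !mxE !mul0r !addr0 => /eqP; rewrite eq_sym oner_eq0.
Qed.

Lemma radial_ext_unit (R : realType) (f : 'rV[R]_3 -> R) (n : 'rV[R]_3) :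
  unit_vec n -> radial_ext f n = f n.
Proof. by move=> n1; rewrite /radial_ext /enorm n1 sqrtr1 invr1 scale1r. Qed.

(** * Spherical coordinates *)

Lemma circle_param (R : realType) (x y : R) : x ^+ 2 + y ^+ 2 = 1 ->
  exists t : R, [/\ 0 <= t < 2 * pi, cos t = x & sin t = y].
Proof.
move=> xy1.
have x1 : -1 <= x <= 1 by apply/andP; split; nra.
have pi0 := pi_gt0 R.
have cx : cos (acos x) = x by rewrite acosK// in_itv.
have sx : sin (acos x) = `|y|.
  by rewrite sin_acos// -xy1 addrAC subrr add0r sqrtr_sqr.
have [y0|y0] := leP 0 y.
  exists (acos x); split => //; last by rewrite sx ger0_norm.
  have := acos_ge0 x1; have := acos_lepi x1; lra.
have x_lt1 : -1 <= x < 1 by apply/andP; split; nra.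
have E : 2 * pi - acos x = - acos x + pi *+ 2 by rewrite mulr2n; ring.
exists (2 * pi - acos x); split.
- have := acos_gt0 x_lt1; have := acos_lepi x1; lra.
- by rewrite E cosD2pi cosN.
- by rewrite E sinD2pi sinN sx ltr0_norm// opprK.
Qed.

Lemma normal_vec0 (R : realType) (t u : R) :
  normal_vec t u 0 0 = cos t * sin u.
Proof. by rewrite mxE. Qed.

Lemma normal_vec1 (R : realType) (t u : R) :
  normal_vec t u 0 1 = sin t * sin u.
Proof. by rewrite mxE. Qed.

Lemma normal_vec2 (R : realType) (t u : R) :
  normal_vec t u 0 (inord 2) = cos u.
Proof. by rewrite mxE inordK. Qed.

Lemma unit_vec_param (R : realType) (n : 'rV[R]_3) : unit_vec n ->
  exists t u : R, param_range t u /\ n = normal_vec t u.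
Proof.
rewrite /unit_vec dotE.
move Ea : (n 0 0) => a; move Eb : (n 0 1) => b.
move Ec : (n 0 (inord 2)) => c n1.
have c1 : -1 <= c <= 1 by apply/andP; split; nra.
have hu : 0 <= acos c <= pi by rewrite acos_ge0// acos_lepi.
have cu : cos (acos c) = c by rewrite acosK// in_itv.
have su : sin (acos c) ^+ 2 = a ^+ 2 + b ^+ 2.
  by have := cos2Dsin2 (acos c); rewrite cu => su; lra.
have pi0 := pi_gt0 R.
have [s0|s0] := eqVneq (sin (acos c)) 0.
  (* At the poles the longitude is arbitrary. *)
  exists 0, (acos c); split; first by rewrite /param_range hu lexx /= mulr_gt0.
  move: su; rewrite s0 => su.
  have a0 : a = 0 by nra.
  have b0 : b = 0 by nra.
  apply: row3P.
  - by rewrite normal_vec0 s0 mulr0 Ea.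
  - by rewrite normal_vec1 s0 mulr0 Eb.
  - by rewrite normal_vec2 cu.
have ab1 : (a / sin (acos c)) ^+ 2 + (b / sin (acos c)) ^+ 2 = 1.
  by rewrite !expr_div_n -mulrDl -su divff// expf_neq0.
have [t [ht ct st]] := circle_param _ _ _ ab1.
exists t, (acos c); split => //; apply: row3P.
- by rewrite normal_vec0 ct divfK.
- by rewrite normal_vec1 st divfK.
- by rewrite normal_vec2 cu.
Qed.

Lemma normal_vec_unit (R : realType) (t u : R) : unit_vec (normal_vec t u).
Proof.
rewrite /unit_vec dotE normal_vec0 normal_vec1 normal_vec2.
have := cos2Dsin2 t; have := cos2Dsin2 u => hu ht.
transitivity ((cos t ^+ 2 + sin t ^+ 2) * sin u ^+ 2 + cos u ^+ 2); first by ring.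
by rewrite ht mul1r addrC.
Qed.

Lemma normal_vec_opp (R : realType) (t u : R) :
  normal_vec (t + pi) (pi - u) = - normal_vec t u.
Proof.
have s : sin (pi - u) = sin u by rewrite addrC sinDpi sinN opprK.
have c : cos (pi - u) = - cos u by rewrite addrC cosDpi cosN.
apply: row3P; rewrite [in RHS]mxE ?(normal_vec0, normal_vec1, normal_vec2).
- by rewrite s cosDpi mulNr.
- by rewrite s sinDpi mulNr.
- by [].
Qed.

Lemma support_fun_antipodal (R : realType) (S : set 'rV[R]_3) (w : R) :
  constant_width S w -> forall n : 'rV[R]_3, unit_vec n ->
  support_fun S (- n) = w - support_fun S n.
Proof.
move=> hw n /unit_vec_param[t [u [tu ->]]].
rewrite -(hw t u tu) /width /support_param normal_vec_opp; ring.
Qed.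

(** * Differentiation and the antipodal map *)

(** No differentiability is needed: both difference quotients are the same. *)
Lemma derive_at_opp (R : realType) (V W : normedModType R) (g : V -> W)
    (x v : V) :
  'D_v g (- x) = 'D_(- v) (g \o -%R) x.
Proof.
rewrite /derive; do 2 f_equal; apply/funext => h /=.
by rewrite opprD -scalerN opprK.
Qed.

Lemma deriveN_dir (R : realType) (V W : normedModType R) (g : V -> W)
    (x v : V) :
  differentiable g x -> 'D_(- v) g x = - 'D_v g x.
Proof. by move=> dg; rewrite !deriveE// linearN. Qed.

Lemma near_neq0 (R : realType) (x : 'rV[R]_3) :
  x != 0 -> \forall y \near x, y != 0.
Proof.
move=> x0; suff o : open [set y : 'rV[R]_3 | y != 0].
  exact: open_nbhs_nbhs.
have -> : [set y : 'rV[R]_3 | y != 0] = ~` [set 0].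
  by apply/seteqP; split => y /=; move/eqP.
rewrite openC; apply: accessible_closed_set1.
exact/hausdorff_accessible/norm_hausdorff.
Qed.

(** * Functions with constant sum at antipodal points *)

Lemma radial_ext_opp (R : realType) (f : 'rV[R]_3 -> R) (w : R)
    (fN : forall n, unit_vec n -> f (- n) = w - f n) (x : 'rV[R]_3) :
  x != 0 -> radial_ext f (- x) = w - radial_ext f x.
Proof.
move=> x0; rewrite /radial_ext /enorm dotNN scalerN fN//.
exact: unit_vec_normalize.
Qed.

Lemma sphere_grad_opp (R : realType) (f : 'rV[R]_3 -> R) (w : R)
    (fC2 : C2_on_sphere f)
    (fN : forall n, unit_vec n -> f (- n) = w - f n) (x : 'rV[R]_3) :
  x != 0 -> sphere_grad f (- x) = sphere_grad f x.
Proof.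
move=> x0; have [df _ _] := fC2 x x0.
apply/rowP => i; rewrite !mxE derive_at_opp.
have -> : 'D_(- basis_vec R i) (radial_ext f \o -%R) x =
          'D_(- basis_vec R i) (cst w - radial_ext f) x.
  apply: near_eq_derive; apply: filterS (near_neq0 _ _ x0) => y y0.
  by rewrite /= (radial_ext_opp _ _ _ fN).
rewrite deriveB; last 2 first.
- exact: derivable_cst.
- exact: diff_derivable.
by rewrite derive_cst sub0r deriveN_dir// opprK.
Qed.

Lemma sphere_hessian_opp (R : realType) (f : 'rV[R]_3 -> R) (w : R)
    (fC2 : C2_on_sphere f)
    (fN : forall n, unit_vec n -> f (- n) = w - f n) (n v : 'rV[R]_3) :
  n != 0 -> sphere_hessian f (- n) v = - sphere_hessian f n v.
Proof.
move=> n0; have [_ dG _] := fC2 n n0.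
have E : 'D_v (sphere_grad f) (- n) = - 'D_v (sphere_grad f) n.
  rewrite (derive_at_opp _ _ _ (sphere_grad f)).
  apply: etrans (deriveN_dir _ _ _ _ _ v dG).
  apply: near_eq_derive; apply: filterS (near_neq0 _ _ n0) => y y0.
  by rewrite /= (sphere_grad_opp _ _ _ fC2 fN).
rewrite /sphere_hessian E.
by rewrite /tangent_proj dotNN scalerN opprD opprK.
Qed.

Lemma radius_eigenvalue_opp (R : realType) (f : 'rV[R]_3 -> R) (w : R)
    (fC2 : C2_on_sphere f)
    (fN : forall n, unit_vec n -> f (- n) = w - f n) (n : 'rV[R]_3) (a : R) :
  unit_vec n -> radius_eigenvalue f n a -> radius_eigenvalue f (- n) (w - a).
Proof.
move=> n1 [v [v0 vn Hv]]; exists v; split => //.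
  by rewrite dotNr vn oppr0.
rewrite (sphere_hessian_opp _ _ _ fC2 fN) ?unit_vec_neq0// fN//.
rewrite [RHS]scalerBl -Hv scalerBl.
by rewrite [LHS]addrCA -opprD.
Qed.

Theorem mainTheorem4 (R : realType) (Sigma : set 'rV[R]_3) (w : R)
    (rho0 rho1 : 'rV[R]_3 -> R) (P Q : 'rV[R]_3)
    (hovoid : ovoid Sigma)
    (hC2 : C2_on_sphere (support_fun Sigma))
    (hw : 0 < w)
    (hwidth : constant_width Sigma w)
    (hrho : principal_radii Sigma rho0 rho1)
    (hP : Sigma P) (hQ : Sigma Q)
    (hPQ : opposite Sigma P Q) :
  rho0 P + rho1 Q = w.
Proof.
have [t [u [_ nP]]] := hPQ; rewrite /has_param normal_vec_opp => nQ.
have n1 := normal_vec_unit _ t u.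
have [leP eigP] := hrho _ _ nP; have [leQ eigQ] := hrho _ _ nQ.
have eigN := radius_eigenvalue_opp _ _ _ hC2 (support_fun_antipodal _ _ _ hwidth).
have P0 : w - rho0 P = rho0 Q \/ w - rho0 P = rho1 Q.
  by apply/eigQ/eigN => //; apply/eigP; left.
have P1 : w - rho1 P = rho0 Q \/ w - rho1 P = rho1 Q.
  by apply/eigQ/eigN => //; apply/eigP; right.
(* [P0] and [P1] allow both images to be [rho0 Q]; the reverse inclusion of
   eigenvalues excludes this unless all the values agree. *)
have Nn1 : unit_vec (- normal_vec t u) by rewrite /unit_vec dotNN.
have Q1 : w - rho1 Q = rho0 P \/ w - rho1 Q = rho1 P.
  by rewrite -eigP -[normal_vec t u]opprK; apply/eigN => //; apply/eigQ; right.
by case: P0 => P0; case: P1 => P1; case: Q1 => Q1; lra.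
Qed.
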